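(* For a cartesian linearly distributive category (CLDC) $\mathbb{X}$, the following are equivalent: (i) $\mathbb{X}$ is a semi-additive category; (ii) $\mathbb{X}$ is compact; (iii) $\mathbb{X}$ has invertible linear distributors (i.e. all components of $\delta^L$ and $\delta^R$ are isomorphisms); (iv) $\mathbb{X}$ is isomix.
   Context: Composition is written in diagrammatic order: $f;g$ means first $f$, then $g$. For finite products write $\times$, terminal object $\top$, projections $\pi^0,\pi^1$, pairing $\langle -,-\rangle$, $t_A:A\to\top$; for finite coproducts write $+$, initial object $\bot$, injections $\iota^0,\iota^1$, copairing $[-,-]$, $b_A:\bot\to A$. The canonical structure isomorphisms are $\alpha^\times_{A,B,C}:(A\times B)\times C\to A\times(B\times C)$, $r^\times_A:A\to A\times\top$, $l^\times_A:A\to\top\times A$, $\sigma^\times_{A,B}:A\times B\to B\times A$, and $\alpha^+_{A,B,C}:A+(B+C)\to(A+B)+C$, $r^+_A:A+\bot\to A$, $l^+_A:\bot+A\to A$, $\sigma^+_{A,B}:A+B\to B+A$. A cartesian linearly distributive category (CLDC) is a category with finite products and finite coproducts (a symmetric linearly distributive category whose tensor is the product and whose par is the coproduct), equipped with natural transformations (linear distributors) $\delta^R_{A,B,C}:(A+B)\times C\to A+(B\times C)$ and $\delta^L_{A,B,C}:A\times(B+C)\to(A\times B)+C$ such that for all objects: (1) $l^\times_{A+B};\delta^L_{\top,A,B}=l^\times_A+1_B$; $r^\times_{A+B};\delta^R_{A,B,\top}=1_A+r^\times_B$; $\delta^R_{\bot,A,B};l^+_{A\times B}=l^+_A\times 1_B$;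 $\delta^L_{A,B,\bot};r^+_{A\times B}=1_A\times r^+_B$. (2) $\delta^L_{A\times B,C,D};(\alpha^\times_{A,B,C}+1_D)=\alpha^\times_{A,B,C+D};(1_A\times\delta^L_{B,C,D});\delta^L_{A,B\times C,D}$; $(\alpha^+_{A,B,C}\times 1_D);\delta^R_{A+B,C,D}=\delta^R_{A,B+C,D};(1_A+\delta^R_{B,C,D});\alpha^+_{A,B,C\times D}$; $\delta^L_{A,B,C+D};\alpha^+_{A\times B,C,D}=(1_A\times\alpha^+_{B,C,D});\delta^L_{A,B+C,D};(\delta^L_{A,B,C}+1_D)$; $\alpha^\times_{A+B,C,D};\delta^R_{A,B,C\times D}=(\delta^R_{A,B,C}\times 1_D);\delta^R_{A,B\times C,D};(1_A+\alpha^\times_{B,C,D})$. (3) $\delta^L_{A+B,C,D};(\delta^R_{A,B,C}+1_D)=\delta^R_{A,B,C+D};(1_A+\delta^L_{B,C,D});\alpha^+_{A,B\times C,D}$; $(\delta^L_{A,B,C}\times 1_D);\delta^R_{A\times B,C,D}=\alpha^\times_{A,B+C,D};(1_A\times\delta^R_{B,C,D});\delta^L_{A,B,C\times D}$. (4) $\delta^R_{A,B,C}=\sigma^\times_{A+B,C};(1_C\times\sigma^+_{A,B});\delta^L_{C,B,A};(\sigma^\times_{C,B}+1_A);\sigma^+_{B\times C,A}$. Let $m:\bot\to\top$ be the unique map (the nullary mix map). The mix map $\mathrm{mix}_{A,B}:A\times B\to A+B$ is the composite $(1_A\times (l^+_B)^{-1});(1_A\times(m+1_B));\delta^L_{A,\top,B};((r^\times_A)^{-1}+1_B)$,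 which in every CLDC equals $((r^+_A)^{-1}\times 1_B);((1_A+m)\times 1_B);\delta^R_{A,\top,B};(1_A+(l^\times_B)^{-1})$; this equality is what it means to be mix, and every CLDC is mix. A CLDC is isomix if $m:\bot\to\top$ is an isomorphism, and compact if it is isomix and every $\mathrm{mix}_{A,B}$ is an isomorphism. A semi-additive category is a category with a zero object, finite products and finite coproducts such that the canonical natural transformation $\psi_{A,B}=[\langle 1_A,0_{A,B}\rangle,\langle 0_{B,A},1_B\rangle]:A+B\to A\times B$ is an isomorphism, where $0_{A,B}$ is the map factoring through the zero object. *)

(* Defs.v *)
Set Implicit Arguments.
Unset Strict Implicit.
Unset Printing Implicit Defensive.

Declare Scope cat_scope.
Delimit Scope cat_scope with cat.
Local Open Scope cat_scope.

Reserved Notation "f ;; g" (at level 55, left associativity).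
Reserved Notation "A × B" (at level 40, left associativity).
Reserved Notation "f [×] g" (at level 40, left associativity).
Reserved Notation "f [+] g" (at level 50, left associativity).

(* Composition is in diagrammatic order: [comp f g] is first [f], then [g]. *)
Record category := Category {
  ob :> Type;
  hom : ob -> ob -> Type;
  idm : forall A, hom A A;
  comp : forall A B C, hom A B -> hom B C -> hom A C;
  comp_idl : forall A B (f : hom A B), comp (idm A) f = f;
  comp_idr : forall A B (f : hom A B), comp f (idm B) = f;
  comp_assoc : forall A B C D (f : hom A B) (g : hom B C) (h : hom C D),
    comp (comp f g) h = comp f (comp g h)
}.

Arguments hom {_} _ _.
Arguments idm {_} _.

Notation "f ;; g" := (comp f g) : cat_scope.

Definition is_iso (X : category) (A B : X) (f : hom A B) : Prop :=
  exists g : hom B A, f ;; g = idm A /\ g ;; f = idm B.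

(* Chosen finite products and finite coproducts, given by a terminal object
   and binary products, and dually. *)
Record bicartesian := Bicartesian {
  bicart_cat :> category;

  top : bicart_cat;
  to_top : forall A : bicart_cat, hom A top;
  to_top_uniq : forall (A : bicart_cat) (f : hom A top), f = to_top A;

  prod : bicart_cat -> bicart_cat -> bicart_cat;
  pi0 : forall A B, hom (prod A B) A;
  pi1 : forall A B, hom (prod A B) B;
  pair : forall T A B : bicart_cat, hom T A -> hom T B -> hom T (prod A B);
  pair_pi0 : forall (T A B : bicart_cat) (f : hom T A) (g : hom T B),
    pair f g ;; pi0 A B = f;
  pair_pi1 : forall (T A B : bicart_cat) (f : hom T A) (g : hom T B),
    pair f g ;; pi1 A B = g;
  pair_uniq : forall (T A B : bicart_cat) (h : hom T (prod A B)),
    h = pair (h ;; pi0 A B) (h ;; pi1 A B);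

  bot : bicart_cat;
  from_bot : forall A : bicart_cat, hom bot A;
  from_bot_uniq : forall (A : bicart_cat) (f : hom bot A), f = from_bot A;

  coprod : bicart_cat -> bicart_cat -> bicart_cat;
  iota0 : forall A B, hom A (coprod A B);
  iota1 : forall A B, hom B (coprod A B);
  copair : forall A B T : bicart_cat, hom A T -> hom B T -> hom (coprod A B) T;
  iota0_copair : forall (A B T : bicart_cat) (f : hom A T) (g : hom B T),
    iota0 A B ;; copair f g = f;
  iota1_copair : forall (A B T : bicart_cat) (f : hom A T) (g : hom B T),
    iota1 A B ;; copair f g = g;
  copair_uniq : forall (A B T : bicart_cat) (h : hom (coprod A B) T),
    h = copair (iota0 A B ;; h) (iota1 A B ;; h)
}.

Arguments top {_}.
Arguments to_top {_} _.
Arguments pi0 {_} _ _.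
Arguments pi1 {_} _ _.
Arguments bot {_}.
Arguments from_bot {_} _.
Arguments iota0 {_} _ _.
Arguments iota1 {_} _ _.

Notation "⊤" := top : cat_scope.
Notation "⊥" := bot : cat_scope.
Notation "A × B" := (prod A B) : cat_scope.
Notation "A + B" := (coprod A B) : cat_scope.

Section BicartesianMaps.
Context {X : bicartesian}.
Implicit Types A B C : X.

Definition prodm A A' B B' (f : hom A A') (g : hom B B') :
    hom (A × B) (A' × B') :=
  pair (pi0 A B ;; f) (pi1 A B ;; g).

Definition coprodm A A' B B' (f : hom A A') (g : hom B B') :
    hom (A + B) (A' + B') :=
  copair (f ;; iota0 A' B') (g ;; iota1 A' B').

Definition prod_assoc A B C : hom ((A × B) × C) (A × (B × C)) :=
  pair (pi0 (A × B) C ;; pi0 A B)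
       (pair (pi0 (A × B) C ;; pi1 A B) (pi1 (A × B) C)).

Definition prod_r A : hom A (A × ⊤) := pair (idm A) (to_top A).
Definition prod_l A : hom A (⊤ × A) := pair (to_top A) (idm A).
Definition prod_sym A B : hom (A × B) (B × A) := pair (pi1 A B) (pi0 A B).

Definition coprod_assoc A B C : hom (A + (B + C)) ((A + B) + C) :=
  copair (iota0 A B ;; iota0 (A + B) C)
         (copair (iota1 A B ;; iota0 (A + B) C) (iota1 (A + B) C)).

Definition coprod_r A : hom (A + ⊥) A := copair (idm A) (from_bot A).
Definition coprod_l A : hom (⊥ + A) A := copair (from_bot A) (idm A).
Definition coprod_sym A B : hom (A + B) (B + A) :=
  copair (iota1 B A) (iota0 B A).

Definition prod_r_inv A : hom (A × ⊤) A := pi0 A ⊤.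
Definition coprod_l_inv A : hom A (⊥ + A) := iota1 ⊥ A.

Lemma prod_rK A : prod_r A ;; prod_r_inv A = idm A.
Proof. apply pair_pi0. Qed.

Lemma prod_r_invK A : prod_r_inv A ;; prod_r A = idm (A × ⊤).
Proof.
rewrite (pair_uniq (idm _)), (pair_uniq (prod_r_inv A ;; prod_r A)).
unfold prod_r, prod_r_inv; rewrite !comp_assoc, pair_pi0, pair_pi1.
rewrite comp_idr, !comp_idl; f_equal.
exact (eq_trans (to_top_uniq _) (eq_sym (to_top_uniq _))).
Qed.

Lemma coprod_l_invK A : coprod_l_inv A ;; coprod_l A = idm A.
Proof. apply iota1_copair. Qed.

Lemma coprod_lK A : coprod_l A ;; coprod_l_inv A = idm (⊥ + A).
Proof.
rewrite (copair_uniq (idm _)), (copair_uniq (coprod_l A ;; coprod_l_inv A)).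
unfold coprod_l, coprod_l_inv; rewrite <- !comp_assoc, iota0_copair, iota1_copair.
rewrite !comp_idr, comp_idl; f_equal.
exact (eq_trans (from_bot_uniq _) (eq_sym (from_bot_uniq _))).
Qed.

Definition nullary_mix : hom (⊥ : X) ⊤ := to_top ⊥.

End BicartesianMaps.

Notation "f [×] g" := (prodm f g) : cat_scope.
Notation "f [+] g" := (coprodm f g) : cat_scope.

Record cldc := CLDC {
  cldc_bicart :> bicartesian;

  deltaR : forall A B C : cldc_bicart, hom ((A + B) × C) (A + (B × C));
  deltaL : forall A B C : cldc_bicart, hom (A × (B + C)) ((A × B) + C);

  deltaR_natural : forall (A A' B B' C C' : cldc_bicart)
      (f : hom A A') (g : hom B B') (h : hom C C'),
    ((f [+] g) [×] h) ;; deltaR A' B' C' = deltaR A B C ;; (f [+] (g [×] h));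
  deltaL_natural : forall (A A' B B' C C' : cldc_bicart)
      (f : hom A A') (g : hom B B') (h : hom C C'),
    (f [×] (g [+] h)) ;; deltaL A' B' C' = deltaL A B C ;; ((f [×] g) [+] h);

  deltaL_top : forall A B : cldc_bicart,
    prod_l (A + B) ;; deltaL ⊤ A B = prod_l A [+] idm B;
  deltaR_top : forall A B : cldc_bicart,
    prod_r (A + B) ;; deltaR A B ⊤ = idm A [+] prod_r B;
  deltaR_bot : forall A B : cldc_bicart,
    deltaR ⊥ A B ;; coprod_l (A × B) = coprod_l A [×] idm B;
  deltaL_bot : forall A B : cldc_bicart,
    deltaL A B ⊥ ;; coprod_r (A × B) = idm A [×] coprod_r B;

  deltaL_prod_assoc : forall A B C D : cldc_bicart,
    deltaL (A × B) C D ;; (prod_assoc A B C [+] idm D)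
    = prod_assoc A B (C + D) ;; (idm A [×] deltaL B C D) ;; deltaL A (B × C) D;
  deltaR_coprod_assoc : forall A B C D : cldc_bicart,
    (coprod_assoc A B C [×] idm D) ;; deltaR (A + B) C D
    = deltaR A (B + C) D ;; (idm A [+] deltaR B C D) ;; coprod_assoc A B (C × D);
  deltaL_coprod_assoc : forall A B C D : cldc_bicart,
    deltaL A B (C + D) ;; coprod_assoc (A × B) C D
    = (idm A [×] coprod_assoc B C D) ;; deltaL A (B + C) D
      ;; (deltaL A B C [+] idm D);
  deltaR_prod_assoc : forall A B C D : cldc_bicart,
    prod_assoc (A + B) C D ;; deltaR A B (C × D)
    = (deltaR A B C [×] idm D) ;; deltaR A (B × C) D
      ;; (idm A [+] prod_assoc B C D);

  deltaL_deltaR : forall A B C D : cldc_bicart,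
    deltaL (A + B) C D ;; (deltaR A B C [+] idm D)
    = deltaR A B (C + D) ;; (idm A [+] deltaL B C D) ;; coprod_assoc A (B × C) D;
  deltaR_deltaL : forall A B C D : cldc_bicart,
    (deltaL A B C [×] idm D) ;; deltaR (A × B) C D
    = prod_assoc A (B + C) D ;; (idm A [×] deltaR B C D) ;; deltaL A B (C × D);

  deltaR_deltaL_sym : forall A B C : cldc_bicart,
    deltaR A B C
    = prod_sym (A + B) C ;; (idm C [×] coprod_sym A B) ;; deltaL C B A
      ;; (prod_sym C B [+] idm A) ;; coprod_sym (B × C) A
}.

Arguments deltaR {_} _ _ _.
Arguments deltaL {_} _ _ _.

Definition mix (X : cldc) (A B : X) : hom (A × B) (A + B) :=
  (idm A [×] coprod_l_inv B) ;; (idm A [×] (nullary_mix [+] idm B))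
  ;; deltaL A ⊤ B ;; (prod_r_inv A [+] idm B).

Definition isomix (X : cldc) : Prop := is_iso (nullary_mix (X := X)).

Definition compact (X : cldc) : Prop :=
  isomix X /\ forall A B : X, is_iso (mix A B).

Definition invertible_distributors (X : cldc) : Prop :=
  (forall A B C : X, is_iso (deltaL A B C)) /\
  (forall A B C : X, is_iso (deltaR A B C)).

Record zero_object (X : category) := ZeroObject {
  zero :> X;
  to_zero : forall A : X, hom A zero;
  to_zero_uniq : forall (A : X) (f : hom A zero), f = to_zero A;
  from_zero : forall A : X, hom zero A;
  from_zero_uniq : forall (A : X) (f : hom zero A), f = from_zero A
}.

Definition zero_map (X : category) (Z : zero_object X) (A B : X) : hom A B :=
  to_zero Z A ;; from_zero Z B.

Definition psi (X : bicartesian) (Z : zero_object X) (A B : X) :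
    hom (A + B) (A × B) :=
  copair (pair (idm A) (zero_map Z A B)) (pair (zero_map Z B A) (idm B)).

Definition semi_additive (X : bicartesian) : Prop :=
  exists Z : zero_object X, forall A B : X, is_iso (psi Z A B).

(* Main.v *)
Require Import Defs.

(** Each of the four conditions amounts to the existence of a map [⊤ -> ⊥].
    Such a map is automatically inverse to the nullary mix map, since [⊥] has
    only one endomorphism and so has [⊤].  A zero object gives such a map, and
    so do invertible distributors: the inverse of [deltaL ⊥ ⊥ ⊤] turns the
    injection of [⊤] into [(⊥ × ⊥) + ⊤] into a map [⊤ -> ⊥ × (⊥ + ⊤)], which
    is then projected to [⊥].

    Conversely, if [⊥ -> ⊤] is invertible then [⊥] is a zero object, and in a
    CLDC a zero object [Z] forces everything else.  The unit axioms determine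
    the mix maps at the units: [mix A ⊥] is [π0 ; ι0] and [mix ⊤ B] is
    [π1 ; ι1] ([mix_bot], [mix_top]).  Any zero map factors through [⊥] and
    through [⊤], so naturality of mix reduces the four composites of
    [mix A B] with the components of [psi Z A B] to these two cases, whence
    mix is a two-sided inverse of [psi].  Applying the same reduction to
    [deltaL], whose components at [⊤] and [⊥] are also given by the unit
    axioms, shows that under the isomorphisms [psi] it is the inverse
    associator of the product ([deltaL_psi]); so it is invertible, and
    [deltaR] is its conjugate by symmetries. *)

Set Implicit Arguments.
Unset Strict Implicit.
Unset Printing Implicit Defensive.

Local Open Scope cat_scope.

(** * Isomorphisms *)

Section Isomorphisms.
Context {X : category}.

Lemma is_iso_comp (A B C : X) (f : hom A B) (g : hom B C) :
  is_iso f -> is_iso g -> is_iso (f ;; g).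
Proof.
intros [f' [ff' f'f]] [g' [gg' g'g]]; exists (g' ;; f'); split.
- now rewrite comp_assoc, <- (comp_assoc g), gg', comp_idl.
- now rewrite comp_assoc, <- (comp_assoc f'), f'f, comp_idl.
Qed.

Lemma is_iso_cancel_r (A B C : X) (f : hom A B) (g : hom B C) :
  is_iso g -> is_iso (f ;; g) -> is_iso f.
Proof.
intros [g' [gg' g'g]] fg_iso.
replace f with (f ;; g ;; g') by now rewrite comp_assoc, gg', comp_idr.
apply is_iso_comp; [exact fg_iso | now exists g].
Qed.

End Isomorphisms.

(** * Calculus of finite products and coproducts *)

Section Bicartesian.
Context {X : bicartesian}.
Implicit Types A B C : X.

Lemma top_ext A (f g : hom A ⊤) : f = g.
Proof. now rewrite (to_top_uniq f), (to_top_uniq g). Qed.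

Lemma bot_ext A (f g : hom ⊥ A) : f = g.
Proof. now rewrite (from_bot_uniq f), (from_bot_uniq g). Qed.

Lemma prod_ext T A B (f g : hom T (A × B)) :
  f ;; pi0 A B = g ;; pi0 A B -> f ;; pi1 A B = g ;; pi1 A B -> f = g.
Proof.
intros e0 e1; rewrite (pair_uniq f), (pair_uniq g), e0, e1; reflexivity.
Qed.

Lemma coprod_ext T A B (f g : hom (A + B) T) :
  iota0 A B ;; f = iota0 A B ;; g -> iota1 A B ;; f = iota1 A B ;; g -> f = g.
Proof.
intros e0 e1; rewrite (copair_uniq f), (copair_uniq g), e0, e1; reflexivity.
Qed.

Lemma pair_pi0_comp T A B C (f : hom T A) (g : hom T B) (h : hom A C) :
  pair f g ;; (pi0 A B ;; h) = f ;; h.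
Proof. now rewrite <- comp_assoc, pair_pi0. Qed.

Lemma pair_pi1_comp T A B C (f : hom T A) (g : hom T B) (h : hom B C) :
  pair f g ;; (pi1 A B ;; h) = g ;; h.
Proof. now rewrite <- comp_assoc, pair_pi1. Qed.

Lemma pair_prodm T A A' B B' (f : hom T A) (g : hom T B)
    (h : hom A A') (k : hom B B') :
  pair f g ;; (h [×] k) = pair (f ;; h) (g ;; k).
Proof.
unfold prodm; apply prod_ext; rewrite comp_assoc, ?pair_pi0, ?pair_pi1,
  <- comp_assoc, ?pair_pi0, ?pair_pi1; reflexivity.
Qed.

Lemma coprodm_copair T A A' B B' (h : hom A A') (k : hom B B')
    (f : hom A' T) (g : hom B' T) :
  (h [+] k) ;; copair f g = copair (h ;; f) (k ;; g).
Proof.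
unfold coprodm; apply coprod_ext; rewrite <- comp_assoc, ?iota0_copair,
  ?iota1_copair, comp_assoc, ?iota0_copair, ?iota1_copair; reflexivity.
Qed.

Lemma prodm_pi0 A A' B B' (f : hom A A') (g : hom B B') :
  (f [×] g) ;; pi0 A' B' = pi0 A B ;; f.
Proof. apply pair_pi0. Qed.

Lemma prodm_pi1 A A' B B' (f : hom A A') (g : hom B B') :
  (f [×] g) ;; pi1 A' B' = pi1 A B ;; g.
Proof. apply pair_pi1. Qed.

Lemma iota0_coprodm A A' B B' (f : hom A A') (g : hom B B') :
  iota0 A B ;; (f [+] g) = f ;; iota0 A' B'.
Proof. apply iota0_copair. Qed.

Lemma iota1_coprodm A A' B B' (f : hom A A') (g : hom B B') :
  iota1 A B ;; (f [+] g) = g ;; iota1 A' B'.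
Proof. apply iota1_copair. Qed.

Lemma prodm_comp A A' A'' B B' B'' (f : hom A A') (f' : hom A' A'')
    (g : hom B B') (g' : hom B' B'') :
  (f [×] g) ;; (f' [×] g') = (f ;; f') [×] (g ;; g').
Proof. unfold prodm at 1; now rewrite pair_prodm, !comp_assoc. Qed.

Lemma coprodm_comp A A' A'' B B' B'' (f : hom A A') (f' : hom A' A'')
    (g : hom B B') (g' : hom B' B'') :
  (f [+] g) ;; (f' [+] g') = (f ;; f') [+] (g ;; g').
Proof. unfold coprodm at 2; now rewrite coprodm_copair, <- !comp_assoc. Qed.

Lemma prodm_id A B : idm A [×] idm B = idm (A × B).
Proof.
apply prod_ext; rewrite ?prodm_pi0, ?prodm_pi1, comp_idl, comp_idr; reflexivity.
Qed.

Lemma coprodm_id A B : idm A [+] idm B = idm (A + B).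
Proof.
apply coprod_ext; rewrite ?iota0_coprodm, ?iota1_coprodm, comp_idl, comp_idr;
  reflexivity.
Qed.

Lemma prodm_iso A A' B B' (f : hom A A') (g : hom B B') :
  is_iso f -> is_iso g -> is_iso (f [×] g).
Proof.
intros [f' [ff' f'f]] [g' [gg' g'g]]; exists (f' [×] g').
now rewrite !prodm_comp, ff', f'f, gg', g'g, !prodm_id.
Qed.

Lemma coprodm_iso A A' B B' (f : hom A A') (g : hom B B') :
  is_iso f -> is_iso g -> is_iso (f [+] g).
Proof.
intros [f' [ff' f'f]] [g' [gg' g'g]]; exists (f' [+] g').
now rewrite !coprodm_comp, ff', f'f, gg', g'g, !coprodm_id.
Qed.

Lemma idm_iso A : is_iso (idm A).
Proof. exists (idm A); split; apply comp_idl. Qed.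

Lemma prod_sym_iso A B : is_iso (prod_sym A B).
Proof.
assert (K : forall A B, prod_sym A B ;; prod_sym B A = idm (A × B)).
{ intros C D; unfold prod_sym; apply prod_ext;
    rewrite comp_assoc, comp_idl, ?pair_pi0, !pair_pi1, ?pair_pi0; reflexivity. }
exists (prod_sym B A); split; apply K.
Qed.

Lemma coprod_sym_iso A B : is_iso (coprod_sym A B).
Proof.
assert (K : forall A B, coprod_sym A B ;; coprod_sym B A = idm (A + B)).
{ intros C D; unfold coprod_sym; apply coprod_ext;
    rewrite <- comp_assoc, comp_idr, ?iota0_copair, !iota1_copair, ?iota0_copair;
    reflexivity. }
exists (coprod_sym B A); split; apply K.
Qed.

Lemma prod_assoc_iso A B C : is_iso (prod_assoc A B C).
Proof.
unfold prod_assoc.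
exists (pair (pair (pi0 A (B × C)) (pi1 A (B × C) ;; pi0 B C))
             (pi1 A (B × C) ;; pi1 B C)); split;
  repeat apply prod_ext; rewrite comp_idl;
  repeat rewrite ?comp_assoc, ?pair_pi0_comp, ?pair_pi1_comp, ?pair_pi0,
    ?pair_pi1; reflexivity.
Qed.

Lemma prod_l_invK A : pi1 ⊤ A ;; prod_l A = idm (⊤ × A).
Proof.
unfold prod_l; apply prod_ext; [apply top_ext |].
now rewrite comp_assoc, pair_pi1, comp_idl, comp_idr.
Qed.

Lemma coprod_rK A : coprod_r A ;; iota0 A ⊥ = idm (A + ⊥).
Proof.
unfold coprod_r; apply coprod_ext; [| apply bot_ext].
now rewrite <- comp_assoc, iota0_copair, comp_idl, comp_idr.
Qed.

Lemma coprod_r_natural A B (f : hom A B) :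
  (f [+] idm ⊥) ;; coprod_r B = coprod_r A ;; f.
Proof.
apply coprod_ext; [| apply bot_ext].
unfold coprod_r; rewrite coprodm_copair, <- comp_assoc, !iota0_copair.
now rewrite comp_idl, comp_idr.
Qed.

(** Both composites of [k] with the nullary mix map are identities, being
    endomorphisms of [⊥] and of [⊤]. *)
Lemma isomix_of_top_to_bot (k : hom (⊤ : X) ⊥) :
  is_iso (nullary_mix (X := X)).
Proof. exists k; split; [apply bot_ext | apply top_ext]. Qed.

(** A map into [⊥] is determined by its composite with the isomorphism
    [⊥ -> ⊤], so the initial object is terminal as well. *)
Lemma zero_object_of_isomix :
  is_iso (nullary_mix (X := X)) -> inhabited (zero_object X).
Proof.
intros [k [mk km]].
assert (to_bot_uniq : forall (A : X) (f : hom A ⊥), f = to_top A ;; k).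
{ intros A f; rewrite <- (comp_idr f), <- mk, <- comp_assoc.
  f_equal; apply top_ext. }
exact (inhabits (ZeroObject to_bot_uniq (@from_bot_uniq X))).
Qed.

End Bicartesian.

(** * Zero maps *)

Section ZeroMaps.
Context {X : bicartesian} (Z : zero_object X).
Implicit Types A B C : X.

Lemma comp_zero_map A B C (f : hom A B) :
  f ;; zero_map Z B C = zero_map Z A C.
Proof.
unfold zero_map; rewrite <- comp_assoc; f_equal; apply to_zero_uniq.
Qed.

Lemma zero_map_comp A B C (f : hom B C) :
  zero_map Z A B ;; f = zero_map Z A C.
Proof.
unfold zero_map; rewrite comp_assoc; f_equal; apply from_zero_uniq.
Qed.

Lemma psi_pi0 A B :
  psi Z A B ;; pi0 A B = copair (idm A) (zero_map Z B A).
Proof.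
unfold psi; apply coprod_ext; rewrite <- comp_assoc, ?iota0_copair,
  ?iota1_copair; apply pair_pi0.
Qed.

Lemma psi_pi1 A B :
  psi Z A B ;; pi1 A B = copair (zero_map Z A B) (idm B).
Proof.
unfold psi; apply coprod_ext; rewrite <- comp_assoc, ?iota0_copair,
  ?iota1_copair; apply pair_pi1.
Qed.

(** Collapsing the second summand factors through the unit [⊥], where the
    unit axioms apply. *)
Lemma copair_id_zero A B :
  copair (idm A) (zero_map Z B A) = (idm A [+] zero_map Z B ⊥) ;; coprod_r A.
Proof.
unfold coprod_r; now rewrite coprodm_copair, comp_idl, zero_map_comp.
Qed.

(** Collapsing the first summand factors through any [C], in particular
    through the unit [⊤]. *)
Lemma coprodm_zero_id A B C (f : hom A C) :
  (f [+] idm B) ;; copair (zero_map Z C B) (idm B)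
  = copair (zero_map Z A B) (idm B).
Proof. now rewrite coprodm_copair, comp_idl, comp_zero_map. Qed.

End ZeroMaps.

(** * The mix map and the distributor at the units *)

Section Units.
Context {X : cldc}.
Implicit Types A B C : X.

Lemma deltaL_topE A B : deltaL ⊤ A B = pi1 ⊤ (A + B) ;; (prod_l A [+] idm B).
Proof.
now rewrite <- deltaL_top, <- comp_assoc, prod_l_invK, comp_idl.
Qed.

(** The nullary mix map disappears from the definition, because the summand on
    which it acts is not reached by the second injection. *)
Lemma mixE A B :
  mix A B
  = (idm A [×] iota1 ⊤ B) ;; deltaL A ⊤ B ;; (pi0 A ⊤ [+] idm B).
Proof.
unfold mix, prod_r_inv, coprod_l_inv.
now rewrite prodm_comp, iota1_coprodm, !comp_idl.
Qed.

Lemma mix_natural A A' B B' (f : hom A A') (g : hom B B') :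
  (f [×] g) ;; mix A' B' = mix A B ;; (f [+] g).
Proof.
assert (slide : (pi0 A ⊤ [+] idm B) ;; (f [+] g)
    = ((f [×] idm ⊤) [+] g) ;; (pi0 A' ⊤ [+] idm B')).
{ now rewrite !coprodm_comp, prodm_pi0, comp_idl, comp_idr. }
rewrite !mixE, (comp_assoc _ _ (f [+] g)), slide, !comp_assoc.
rewrite <- (comp_assoc (deltaL A ⊤ B)), <- deltaL_natural, <- !comp_assoc.
now rewrite !prodm_comp, iota1_coprodm, comp_idl, comp_idr.
Qed.

Lemma mix_bot A : mix A ⊥ = pi0 A ⊥ ;; iota0 A ⊥.
Proof.
rewrite <- (comp_idr (mix A ⊥)), <- coprod_rK, <- comp_assoc; f_equal.
rewrite mixE, comp_assoc, coprod_r_natural, comp_assoc.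
rewrite <- (comp_assoc (deltaL A ⊤ ⊥)), deltaL_bot.
now rewrite !prodm_pi0, <- comp_assoc, prodm_pi0, !comp_idr.
Qed.

Lemma mix_top B : mix ⊤ B = pi1 ⊤ B ;; iota1 ⊤ B.
Proof.
rewrite mixE, deltaL_topE, <- comp_assoc, prodm_pi1, !comp_assoc.
now rewrite coprodm_comp, iota1_coprodm, !comp_idl.
Qed.

End Units.

(** * Consequences of a zero object *)

Section ZeroObject.
Context {X : cldc} (Z : zero_object X).
Implicit Types A B C : X.

Lemma pair_id_zero_mix A B :
  pair (idm A) (zero_map Z A B) ;; mix A B = iota0 A B.
Proof.
replace (pair (idm A) (zero_map Z A B))
  with (pair (idm A) (zero_map Z A ⊥) ;; (idm A [×] from_bot B))
  by now rewrite pair_prodm, comp_idl, zero_map_comp.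
rewrite comp_assoc, mix_natural, mix_bot, <- !comp_assoc, pair_pi0.
now rewrite comp_idl, iota0_coprodm, comp_idl.
Qed.

Lemma pair_zero_id_mix A B :
  pair (zero_map Z B A) (idm B) ;; mix A B = iota1 A B.
Proof.
replace (pair (zero_map Z B A) (idm B))
  with (pair (to_top B) (idm B) ;; (zero_map Z ⊤ A [×] idm B))
  by now rewrite pair_prodm, comp_idl, comp_zero_map.
rewrite comp_assoc, mix_natural, mix_top, <- !comp_assoc, pair_pi1.
now rewrite comp_idl, iota1_coprodm, comp_idl.
Qed.

Lemma psi_mix A B : psi Z A B ;; mix A B = idm (A + B).
Proof.
unfold psi; apply coprod_ext; rewrite <- comp_assoc, ?iota0_copair,
  ?iota1_copair, comp_idr; [apply pair_id_zero_mix | apply pair_zero_id_mix].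
Qed.

Lemma mix_psi A B : mix A B ;; psi Z A B = idm (A × B).
Proof.
apply prod_ext; rewrite comp_assoc, comp_idl.
- rewrite psi_pi0, copair_id_zero, <- comp_assoc, <- mix_natural, mix_bot.
  unfold coprod_r; rewrite !comp_assoc, iota0_copair, comp_idr.
  now rewrite prodm_pi0, comp_idr.
- rewrite psi_pi1, <- (coprodm_zero_id Z B (to_top A)), <- comp_assoc.
  rewrite <- mix_natural, mix_top, !comp_assoc, iota1_copair, comp_idr.
  now rewrite prodm_pi1, comp_idr.
Qed.

Lemma psi_iso A B : is_iso (psi Z A B).
Proof. exists (mix A B); split; [apply psi_mix | apply mix_psi]. Qed.

Lemma mix_iso A B : is_iso (mix A B).
Proof. exists (psi Z A B); split; [apply mix_psi | apply psi_mix]. Qed.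

(** The components of [deltaL ;; psi] forget one summand of the codomain, so by
    naturality they only involve [deltaL A B ⊥] and [deltaL ⊤ ⊤ C]. *)
Lemma deltaL_copair_id_zero A B C :
  deltaL A B C ;; copair (idm (A × B)) (zero_map Z C (A × B))
  = idm A [×] copair (idm B) (zero_map Z C B).
Proof.
rewrite copair_id_zero, <- prodm_id, <- comp_assoc, <- deltaL_natural.
now rewrite comp_assoc, deltaL_bot, prodm_comp, comp_idl, <- copair_id_zero.
Qed.

Lemma deltaL_copair_zero_id A B C :
  deltaL A B C ;; copair (zero_map Z (A × B) C) (idm C)
  = pi1 A (B + C) ;; copair (zero_map Z B C) (idm C).
Proof.
rewrite <- (coprodm_zero_id Z C (to_top A [×] to_top B)), <- comp_assoc.
rewrite <- deltaL_natural, deltaL_topE, <- comp_assoc, prodm_pi1, !comp_assoc.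
now rewrite !coprodm_zero_id.
Qed.

(** Through the identification of sums with products, the distributor is the
    rebracketing [A × (B × C) -> (A × B) × C]. *)
Lemma deltaL_psi A B C :
  deltaL A B C ;; psi Z (A × B) C ;; prod_assoc A B C
  = idm A [×] psi Z B C.
Proof.
unfold prod_assoc; apply prod_ext; [| apply prod_ext];
  rewrite !comp_assoc, ?pair_pi1_comp, ?pair_pi0, ?pair_pi1, ?pair_pi0.
- rewrite <- (comp_assoc (psi _ _ _)), psi_pi0, <- comp_assoc.
  now rewrite deltaL_copair_id_zero, !prodm_pi0.
- rewrite <- (comp_assoc (psi _ _ _)), psi_pi0, <- comp_assoc.
  rewrite deltaL_copair_id_zero, prodm_pi1, <- comp_assoc, prodm_pi1.
  now rewrite comp_assoc, psi_pi0.
- rewrite psi_pi1, deltaL_copair_zero_id, <- comp_assoc, prodm_pi1.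
  now rewrite comp_assoc, psi_pi1.
Qed.

Lemma deltaL_iso A B C : is_iso (deltaL A B C).
Proof.
apply is_iso_cancel_r with (g := psi Z (A × B) C); [apply psi_iso |].
apply is_iso_cancel_r with (g := prod_assoc A B C); [apply prod_assoc_iso |].
rewrite deltaL_psi; apply prodm_iso; [apply idm_iso | apply psi_iso].
Qed.

Lemma deltaR_iso A B C : is_iso (deltaR A B C).
Proof.
rewrite deltaR_deltaL_sym.
repeat apply is_iso_comp;
  auto using prod_sym_iso, coprod_sym_iso, prodm_iso, coprodm_iso, idm_iso,
    deltaL_iso.
Qed.

End ZeroObject.

(** * The equivalence *)

Lemma isomix_of_semi_additive (X : cldc) : semi_additive X -> isomix X.
Proof.
intros [Z _]; exact (isomix_of_top_to_bot (zero_map Z ⊤ ⊥)).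
Qed.

(** The inverse of [deltaL ⊥ ⊥ ⊤] carries the summand [⊤] of its domain
    [(⊥ × ⊥) + ⊤] to a product with [⊥] as a factor. *)
Lemma isomix_of_invertible_distributors (X : cldc) :
  invertible_distributors X -> isomix X.
Proof.
intros [deltaL_inv _]; destruct (deltaL_inv ⊥ ⊥ ⊤) as [d _].
exact (isomix_of_top_to_bot (iota1 (⊥ × ⊥) ⊤ ;; d ;; pi0 ⊥ (⊥ + ⊤))).
Qed.

Lemma semi_additive_of_isomix (X : cldc) : isomix X -> semi_additive X.
Proof.
intros iso; destruct (zero_object_of_isomix iso) as [Z].
exists Z; apply psi_iso.
Qed.

Lemma compact_of_isomix (X : cldc) : isomix X -> compact X.
Proof.
intros iso; destruct (zero_object_of_isomix iso) as [Z].
split; [exact iso | apply (mix_iso Z)].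
Qed.

Lemma invertible_distributors_of_isomix (X : cldc) :
  isomix X -> invertible_distributors X.
Proof.
intros iso; destruct (zero_object_of_isomix iso) as [Z].
split; [apply (deltaL_iso Z) | apply (deltaR_iso Z)].
Qed.

Theorem theorem5p12 (X : cldc) :
  (semi_additive X <-> compact X) /\
  (compact X <-> invertible_distributors X) /\
  (invertible_distributors X <-> isomix X).
Proof.
assert (isomix_of_compact : compact X -> isomix X) by now intros [iso _].
split; [| split]; split; auto using isomix_of_semi_additive, isomix_of_invertible_distributors,
  semi_additive_of_isomix, compact_of_isomix, invertible_distributors_of_isomix.
Qed.
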